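(* Let $V=W_1\oplus W_2$ be a finite-dimensional vector space over the non-archimedean field $F$, with $n_i=\dim W_i$ and $1\le n_1\leq n_2$, and let $L=\mathrm{GL}(W_1)\times\mathrm{GL}(W_2)\subset\mathrm{GL}(V)$. Let $[\Lambda_1],[\Lambda_2]$ be vertices of the Euclidean building of $\mathrm{GL}(V)$. Then the orbital distance $d_O(L[\Lambda_1],L[\Lambda_2])$ equals the minimal distance, measured in the $1$-skeleton of the building, between a vertex in the orbit $L[\Lambda_1]$ and a vertex in the orbit $L[\Lambda_2]$.
   Context: $F$ is a non-archimedean field (with a discrete valuation and finite residue field), $\mathcal{O}$ its ring of integers, $\varpi$ a uniformizer, $\mathcal{P}=(\varpi)$; $\mathbb{N}$ contains $0$. An $\mathcal{O}$-lattice in a finite-dimensional $F$-vector space is a finitely generated free $\mathcal{O}$-submodule spanning it over $F$; $[\Lambda]=\{a\Lambda : a\in F^\times\}$ is its homothety class. The vertices of the Euclidean building $\mathcal{B}_e\mathrm{GL}(V)$ are the homothety classes of lattices in $V$; two vertices $\lambda_1,\lambda_2$ are incident if there are representatives $\Lambda_i\in\lambda_i$ with $\varpi\Lambda_1\subset\Lambda_2\subset\Lambda_1$. The $1$-skeleton is the graph on the vertices with edges joining distinct incident vertices, and distance in it is the path metric. $\mathrm{GL}(V)$, hence $L$, acts on vertices by $g[\Lambda]=[g\Lambda]$; $L[\Lambda]$ denotes the $L$-orbit of $[\Lambda]$. Let $p_i:V\to W_i$ be the projections. For a lattice $\Lambda\subset V$ put $P_i(\Lambda)=p_i(\Lambda)$,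 $K_i(\Lambda)=\Lambda\cap W_i\subset P_i(\Lambda)$, and $Q_i(\Lambda)=P_i(\Lambda)/K_i(\Lambda)$. One has $Q_1(\Lambda)\cong Q_2(\Lambda)$; the common isomorphism class of $\mathcal{O}$-modules is denoted $Q(\Lambda)$, and depends only on $[\Lambda]$. Let $A^{n}=\{(\alpha_i)_{i=1}^n\in\mathbb{N}^n : \alpha_i\geq\alpha_{i+1}\}$. The $L$-orbits of vertices are identified with $A^{n_1}$: the orbit $L[\Lambda]$ corresponds to the unique $\alpha\in A^{n_1}$ with $Q(\Lambda)\cong\bigoplus_{i=1}^{n_1}\mathcal{O}/\mathcal{P}^{\alpha_i}$. The orbital distance is $d_O(\alpha,\beta)=\max_{1\le i\le n_1}|\alpha_i-\beta_i|$ for $\alpha,\beta\in A^{n_1}$, transported to orbits by this identification. *)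

(* Defs.v *)
From mathcomp Require Export all_boot all_order all_algebra.
From mathcomp Require Export boolp classical_sets functions cardinality.

Set Implicit Arguments.
Unset Strict Implicit.
Unset Printing Implicit Defensive.

Import Order.TTheory GRing.Theory Num.Theory.
Local Open Scope classical_set_scope.
Local Open Scope ring_scope.

(* The value of [dval] at [0] is irrelevant: every use below excludes [x = 0]. *)
Record discrete_valuation (F : fieldType) := DiscreteValuation {
  dval :> F -> int;
  dvalM : forall x y, x != 0 -> y != 0 -> dval (x * y) = dval x + dval y;
  dvalD : forall x y, x != 0 -> y != 0 -> x + y != 0 ->
    Num.min (dval x) (dval y) <= dval (x + y);
  dval_onto : forall m : int, exists2 x, x != 0 & dval x = m }.

Definition is_minimum (S : set nat) (d : nat) : Prop :=
  S d /\ forall e, S e -> (d <= e)%N.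

Section Cosets.
Variable U : zmodType.
Implicit Types M N : set U.

Definition coset N (x : U) : set U := [set x + y | y in N].

(* The carrier of M / N, for a subgroup N of M. *)
Definition quotient_set M N : set (set U) := [set coset N x | x in M].

End Cosets.

Section IntegerRing.
Variables (F : fieldType) (v : discrete_valuation F).

Definition integers : set F := [set x | x = 0 \/ 0 <= v x].

Definition uniformizer (pi : F) : Prop := pi != 0 /\ v pi = 1.

(* The ideal P^k, where P = (pi). *)
Definition ideal_pow (pi : F) (k : nat) : set F :=
  [set pi ^+ k * x | x in integers].

Definition finite_residue_field (pi : F) : Prop :=
  finite_set (quotient_set integers (ideal_pow pi 1)).

(* M / N and M' / N' are isomorphic as modules over the ring of integers. All
   four sets are meant to be submodules, N of M and N' of M'; the last clause
   is linearity of f for the operations induced on cosets. *)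
Definition quotient_iso (U U' : lmodType F)
    (M N : set U) (M' N' : set U') : Prop :=
  exists f : set U -> set U',
    set_bij (quotient_set M N) (quotient_set M' N') f /\
    forall (a : F) (x y : U) (x' y' : U'),
      integers a -> M x -> M y -> M' x' -> M' y' ->
      f (coset N x) = coset N' x' -> f (coset N y) = coset N' y' ->
      f (coset N (a *: x + y)) = coset N' (a *: x' + y').

(* The direct sum of the O / P^(alpha i) is taken as the quotient of O^n by the
   product of the P^(alpha i), inside F^n. *)
Definition iso_sum_cyclic (pi : F) (U : lmodType F) (M N : set U)
    (n : nat) (alpha : {ffun 'I_n -> nat}) : Prop :=
  quotient_iso M N
    [set x : 'rV[F]_n | forall i, integers (x ord0 i)]
    [set x : 'rV[F]_n | forall i, ideal_pow pi (alpha i) (x ord0 i)].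

End IntegerRing.

Section Building.
Variables (F : fieldType) (v : discrete_valuation F) (pi : F).
Variable V : vectType F.
Implicit Types (L : set V) (x y : set (set V)).

Definition is_lattice L : Prop :=
  exists (n : nat) (e : 'I_n -> V),
    [/\ L = [set \sum_(i < n) c i *: e i
              | c in [set c : 'I_n -> F | forall i, integers v (c i)]],
        forall c : 'I_n -> F, (forall i, integers v (c i)) ->
          \sum_(i < n) c i *: e i = 0 -> forall i, c i = 0
      & forall U : {vspace V}, (forall u, L u -> u \in U) -> U = fullv].

Definition scale_set (a : F) L : set V := [set a *: u | u in L].

Definition homothety_class L : set (set V) :=
  [set scale_set a L | a in [set a : F | a != 0]].

Definition is_vertex x : Prop :=
  exists2 L, is_lattice L & x = homothety_class L.

Definition incident x y : Prop :=
  exists L1 L2, [/\ x L1, y L2, scale_set pi L1 `<=` L2 & L2 `<=` L1].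

Definition adjacent x y : Prop :=
  [/\ is_vertex x, is_vertex y, x <> y & incident x y].

Definition walk x y (p : seq (set (set V))) : Prop :=
  path (fun z t => `[< adjacent z t >]) x p /\ last x p = y.

(* As a relation: [skeleton_dist x y d] says that x and y are connected, at
   distance d. *)
Definition skeleton_dist x y (d : nat) : Prop :=
  is_minimum [set size p | p in walk x y] d.

End Building.

Section LeviOrbits.
Variables (F : fieldType) (v : discrete_valuation F) (pi : F).
Variables (V : vectType F) (W1 W2 : {vspace V}).
Implicit Types (L : set V) (x : set (set V)) (X : set (set (set V))).

(* GL(W1) x GL(W2) embedded in GL(V), when V is the direct sum of W1 and W2. *)
Definition levi : set 'End(V) :=
  [set g | exists (g1 : 'End(subvs_of W1)) (g2 : 'End(subvs_of W2)),
     [/\ bijective g1, bijective g2 &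
         forall w1 w2, g (vsval w1 + vsval w2) = vsval (g1 w1) + vsval (g2 w2)]].

Definition act (g : 'End(V)) x : set (set V) := [set [set g u | u in L] | L in x].

Definition levi_orbit x : set (set (set V)) := [set act g x | g in levi].

Definition proj_lattice (W W' : {vspace V}) L : set V :=
  [set daddv_pi W W' u | u in L].

Definition inter_lattice (W : {vspace V}) L : set V :=
  L `&` [set u | u \in W].

(* Q(L) is the common isomorphism class of Q_1(L) and Q_2(L). *)
Definition Q_iso L (n : nat) (alpha : {ffun 'I_n -> nat}) : Prop :=
  iso_sum_cyclic v pi (proj_lattice W1 W2 L) (inter_lattice W1 L) alpha /\
  iso_sum_cyclic v pi (proj_lattice W2 W1 L) (inter_lattice W2 L) alpha.

Definition decreasing_seqs (n : nat) : set {ffun 'I_n -> nat} :=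
  [set alpha | forall i j : 'I_n, j = i.+1 :> nat -> (alpha j <= alpha i)%N].

(* The element of A^n attached to an orbit; the default value is only used if
   X is not the orbit of a vertex. *)
Definition orbit_label (n : nat) X : {ffun 'I_n -> nat} :=
  xget [ffun=> 0%N]
    [set alpha | decreasing_seqs alpha /\
       exists L, [/\ is_lattice v L, X (homothety_class L) & Q_iso L alpha]].

Definition label_dist (n : nat) (alpha beta : {ffun 'I_n -> nat}) : nat :=
  (\max_(i < n) `|(alpha i)%:Z - (beta i)%:Z|)%N.

Definition orbital_dist X Y : nat :=
  label_dist (orbit_label (\dim W1) X) (orbit_label (\dim W1) Y).

End LeviOrbits.

(* Main.v *)
(* Smith normal form over the valuation ring brings every lattice to the shape
   {phi (x, z) : x, z integral, z_i - x_i in P^(alpha i) for i < n1}, where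
   phi : F^n1 x F^n2 -> V is a linear isomorphism respecting W1 and W2 and alpha
   is decreasing; then Q(Lambda) is the sum of the O / P^(alpha i).  Two such phi
   differ by an element of L, so alpha parametrises the orbits.

   Lower bound: alpha i > k iff pi^k Q needs more than i generators.  If
   pi Lambda1 is in Lambda2 and Lambda2 is in Lambda1, the images of the lattices
   in W1, and likewise their intersections with W1, are nested in the same way,
   so passing from one lattice to the other changes each alpha i by at most 1.

   Upper bound: with fixed bases (e_i), (f_j), raising alpha i by 1 gives a
   neighbouring sublattice, and so does lowering alpha i by 1 while multiplying
   e_i and f_i by pi; all indices can be moved simultaneously, so d steps reach
   distance d. *)

Require Import Defs.
From HB Require Import structures.
From mathcomp Require Import fingroup perm zify.

Set Implicit Arguments.
Unset Strict Implicit.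
Unset Printing Implicit Defensive.

Import Order.TTheory GRing.Theory Num.Theory.
Local Open Scope classical_set_scope.
Local Open Scope ring_scope.

(** * Valuations and Smith normal form *)

Section Valuation.
Variables (F : fieldType) (v : discrete_valuation F).
Implicit Types (m n : int) (x y : F).

(** Here [0] counts as having infinite valuation, since [dval] is arbitrary there. For [m = 0] this
    is convertible to membership in [integers]. *)
Definition val_ge (m : int) (x : F) : Prop := x = 0 \/ m <= v x.

Lemma val_ge0 m : val_ge m 0. Proof. by left. Qed.

Lemma dval1 : v 1 = 0.
Proof.
have := dvalM v (oner_neq0 F) (oner_neq0 F); rewrite mulr1 => /eqP.
by rewrite -subr_eq subrr => /eqP.
Qed.

Lemma dvalV x : x != 0 -> v x^-1 = - v x.
Proof.
move=> x0; apply/eqP; rewrite -addr_eq0 -dvalM ?invr_eq0 // mulVf //.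
by rewrite dval1.
Qed.

Lemma dvalN1 : v (-1) = 0.
Proof.
have n0 : (-1 : F) != 0 by rewrite oppr_eq0 oner_eq0.
have := dvalM v n0 n0; rewrite mulrNN mulr1 dval1; lia.
Qed.

Lemma val_geM m n x y : val_ge m x -> val_ge n y -> val_ge (m + n) (x * y).
Proof.
move=> [->|hx] [->|hy]; rewrite ?(mul0r, mulr0); try by left.
have [->|x0] := eqVneq x 0; first by rewrite mul0r; left.
have [->|y0] := eqVneq y 0; first by rewrite mulr0; left.
by right; rewrite dvalM // lerD.
Qed.

Lemma val_ge0M x y : val_ge 0 x -> val_ge 0 y -> val_ge 0 (x * y).
Proof. by move=> hx hy; rewrite -(addr0 0); apply: val_geM. Qed.

Lemma val_geD m x y : val_ge m x -> val_ge m y -> val_ge m (x + y).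
Proof.
move=> [->|hx] [->|hy]; rewrite ?(add0r, addr0); try by [left|right].
have [->|x0] := eqVneq x 0; first by rewrite add0r; right.
have [->|y0] := eqVneq y 0; first by rewrite addr0; right.
have [->|xy0] := eqVneq (x + y) 0; first by left.
right; apply: le_trans (dvalD v x0 y0 xy0).
by rewrite le_min hx hy.
Qed.

Lemma val_ge_refl x : val_ge (v x) x. Proof. by right. Qed.

Lemma val_ge_int1 : val_ge 0 1. Proof. by right; rewrite dval1. Qed.

Lemma val_geN m x : val_ge m x -> val_ge m (- x).
Proof.
move=> hx; rewrite -mulN1r -(add0r m); apply: val_geM => //.
by right; rewrite dvalN1.
Qed.

Lemma val_geB m x y : val_ge m x -> val_ge m y -> val_ge m (x - y).
Proof. by move=> hx hy; apply/val_geD/val_geN. Qed.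

Lemma val_geW m n x : n <= m -> val_ge m x -> val_ge n x.
Proof. by move=> nm [->|h]; [left|right; apply: le_trans h]. Qed.

Lemma val_ge_sum (I : Type) (r : seq I) (P : pred I) (f : I -> F) m :
  (forall i, P i -> val_ge m (f i)) -> val_ge m (\sum_(i <- r | P i) f i).
Proof.
move=> h; elim/big_rec: _ => [|i x /h Pi hx]; first exact: val_ge0.
exact: val_geD.
Qed.

Lemma val_ge_div m x y : y != 0 -> val_ge m x -> val_ge (m - v y) (x / y).
Proof. by move=> y0 hx; apply: val_geM => //; right; rewrite dvalV. Qed.

Lemma val_ge_shift m x y : y != 0 -> val_ge (v y + m) (y * x) <-> val_ge m x.
Proof.
move=> y0; split=> [h|]; last exact/val_geM/val_ge_refl.
have := val_ge_div y0 h; rewrite mulrC mulKf //.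
by rewrite addrAC subrr add0r.
Qed.

Lemma dvalX x k : x != 0 -> v (x ^+ k) = v x * k%:Z.
Proof.
move=> x0; elim: k => [|k IH]; first by rewrite expr0 dval1 mulr0.
by rewrite exprS dvalM ?expf_neq0 // IH; lia.
Qed.

Lemma ideal_powP (pi : F) k x : uniformizer v pi ->
  ideal_pow v pi k x <-> val_ge k%:Z x.
Proof.
move=> [pi0 vpi]; have e : v (pi ^+ k) = k by rewrite dvalX // vpi mul1r.
split=> [[y hy <-]|h].
  by rewrite -e -[X in val_ge X _]addr0; apply/val_ge_shift; rewrite ?expf_neq0.
exists (pi ^- k * x); last by rewrite mulVKf // expf_neq0.
apply/(val_ge_shift _ _ (expf_neq0 k pi0)).
by rewrite e addr0 mulVKf // expf_neq0.
Qed.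

End Valuation.

(** * Matrices over the valuation ring *)

Section IntegralMatrices.
Variables (F : fieldType) (v : discrete_valuation F).

Definition intmx m n (A : 'M[F]_(m, n)) := forall i j, val_ge v 0 (A i j).

Lemma intmxM m n p (A : 'M_(m, n)) (B : 'M_(n, p)) :
  intmx A -> intmx B -> intmx (A *m B).
Proof.
move=> hA hB i j; rewrite mxE; apply: val_ge_sum => k _.
by apply: val_ge0M.
Qed.

Lemma intmxD m n (A B : 'M_(m, n)) : intmx A -> intmx B -> intmx (A + B).
Proof. by move=> hA hB i j; rewrite mxE; apply: val_geD. Qed.

Lemma intmxB m n (A B : 'M_(m, n)) : intmx A -> intmx B -> intmx (A - B).
Proof. by move=> hA hB i j; rewrite !mxE; apply: val_geB. Qed.

Lemma intmx0 m n : intmx (0 : 'M_(m, n)).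
Proof. by move=> i j; rewrite mxE; left. Qed.

Lemma intmx1 n : intmx (1%:M : 'M_n).
Proof.
by move=> i j; rewrite mxE; case: eqP => _; [apply: val_ge_int1 | left].
Qed.

Lemma intmx_row m n1 n2 (A : 'M_(m, n1)) (B : 'M_(m, n2)) :
  intmx (row_mx A B) <-> intmx A /\ intmx B.
Proof.
split=> [h|[hA hB] i j]; last by rewrite mxE; case: (fintype.split _).
  split=> i j; first by have := h i (lshift _ j); rewrite row_mxEl.
  by have := h i (rshift _ j); rewrite row_mxEr.
Qed.

Lemma intmx_col m1 m2 n (A : 'M_(m1, n)) (B : 'M_(m2, n)) :
  intmx A -> intmx B -> intmx (col_mx A B).
Proof. by move=> hA hB i j; rewrite mxE; case: (fintype.split _). Qed.

(** The group GL_n of the ring of integers, inside the matrices over [F]. *)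
Definition intunit n (A : 'M[F]_n) :=
  [/\ A \in unitmx, intmx A & intmx (invmx A)].

Lemma intunitI n (A B : 'M[F]_n) :
  A *m B = 1%:M -> intmx A -> intmx B -> intunit A.
Proof.
move=> AB hA hB; have [uA uB] := mulmx1_unit AB; split=> //.
by rewrite -[invmx A]mulmx1 -AB mulKmx.
Qed.

Lemma intunitM n (A B : 'M[F]_n) : intunit A -> intunit B -> intunit (A *m B).
Proof.
move=> [uA hA hA'] [uB hB hB'].
apply: (@intunitI _ _ (invmx B *m invmx A)); try exact: intmxM.
by rewrite mulmxA mulmxK // mulmxV.
Qed.

Lemma intunit_perm n (s : 'S_n) : intunit (perm_mx s).
Proof.
have h (t : 'S_n) : intmx (perm_mx t).
  by move=> i j; rewrite !mxE; case: eqP => _; [apply: val_ge_int1 | left].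
apply: (@intunitI _ _ (perm_mx s^-1%g)) => //.
by rewrite -perm_mxM mulgV perm_mx1.
Qed.

Lemma intunit1 n : intunit (1%:M : 'M_n).
Proof. by apply: (@intunitI _ _ 1%:M); rewrite ?mulmx1; try exact: intmx1. Qed.

(** The diagonal is an infinite sequence, so that divisibility along it needs no bound on the
    index. *)
Definition smith_diag m n (d : nat -> F) : 'M[F]_(m, n) :=
  \matrix_(i, j) (d i *+ (i == j :> nat)).

(** Induction on the number of rows: an entry of least valuation divides all others, so it can be
    moved to the corner, scaled to 1 and used to clear its row and column. The last clause feeds the
    induction, giving divisibility of the next diagonal entry by the pivot. *)
Lemma smith m n (C : 'M[F]_(m, n)) : exists X Y d,
  [/\ intunit X, intunit Y, C = X *m smith_diag m n d *m Y,
      forall i, exists2 q, val_ge v 0 q & d i.+1 = q * d i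
    & intmx C -> forall i, val_ge v 0 (d i)].
Proof.
elim: m n C => [|m IH] n C.
  exists 1%:M, 1%:M, (fun=> 0); split; try exact: intunit1; last by left.
  - by apply/matrixP => - [].
  - by exists 0; [left | rewrite mulr0].
have [[i0 j0] /= nz0|C0] := pickP (fun k : 'I_m.+1 * 'I_n => C k.1 k.2 != 0);
    last first.
  exists 1%:M, 1%:M, (fun=> 0); split; try exact: intunit1; last by left.
  - rewrite mul1mx mulmx1; apply/matrixP => i j; rewrite mxE mul0rn.
    exact/eqP/negbFE/(C0 (i, j)).
  - by exists 0; [left | rewrite mulr0].
have [[i j] /= nzC minC] : exists2 k : 'I_m.+1 * 'I_n, C k.1 k.2 != 0 &
    forall k', val_ge v (v (C k.1 k.2)) (C k'.1 k'.2).
  pose P := fun k : 'I_m.+1 * 'I_n => C k.1 k.2 != 0.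
  case: (@arg_minP _ _ _ (i0, j0) P (fun k => v (C k.1 k.2)) nz0) => k Pk mk.
  exists k => // k'; have [->|nz] := eqVneq (C k'.1 k'.2) 0; first by left.
  by right; apply: mk.
case: n C i0 j0 i j nz0 nzC minC => [|n] C i0 j0 i j _ nzC minC.
  by case: j nzC minC.
set a := C i j in nzC minC.
pose M : 'M_(1 + m, 1 + n) := a^-1 *: xcol j 0 (xrow i 0 C).
have intM : intmx M.
  move=> k l; rewrite mxE -(subrr (v a)) mulrC; apply: val_ge_div => //.
  by rewrite !mxE; apply: (minC (_, _)).
have M00 : ulsubmx M = 1.
  by rewrite [_ M]mx11_scalar !mxE !lshift0 !tpermR mulVf.
pose Mu := ursubmx M; pose Ml := dlsubmx M.
have [iMu iMl iMd] : [/\ intmx Mu, intmx Ml & intmx (drsubmx M)].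
  have sub (A : 'M_(1 + m, 1 + n)) : intmx A ->
      [/\ intmx (ursubmx A), intmx (dlsubmx A) & intmx (drsubmx A)].
    by move=> iA; split=> k l; rewrite !mxE.
  exact: sub.
(* Schur complement of the corner entry 1. The matrices [X'] and [Y'] below combine the clearing of
   row and column with the factors of [M1]. *)
pose M1 := - (Ml *m Mu) + drsubmx M.
have iM1 : intmx M1.
  by rewrite /M1 addrC; apply: intmxB => //; apply: intmxM.
have [X [Y [d [uX uY dM1 dd id]]]] := IH _ M1.
pose X' := block_mx 1 0 Ml X; pose Y' := block_mx 1 Mu 0 Y.
have uX' : intunit X'.
  case: uX => ? ? ?.
  apply: (@intunitI _ _ (block_mx 1 0 (- invmx X *m Ml) (invmx X))).
  - rewrite mulmx_block !(mul0mx, mulmx0, addr0, add0r, mul1mx, mulmx1).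
    by rewrite mulNmx mulmxN mulKVmx // subrr mulmxV // -scalar_mx_block.
  - by apply: intmx_col; apply/intmx_row; split=> //;
      [exact: intmx1 | exact: intmx0].
  - apply: intmx_col; apply/intmx_row; split=> //;
      [exact: intmx1 | exact: intmx0|].
    by rewrite mulNmx -[- _]add0r; apply: intmxB; [exact: intmx0 | exact: intmxM].
have uY' : intunit Y'.
  case: uY => ? ? ?.
  apply: (@intunitI _ _ (block_mx 1 (- (Mu *m invmx Y)) 0 (invmx Y))).
  - rewrite mulmx_block !(mul0mx, mulmx0, addr0, add0r, mul1mx, mulmx1).
    by rewrite addNr mulmxV // -scalar_mx_block.
  - by apply: intmx_col; apply/intmx_row; split=> //;
      [exact: intmx1 | exact: intmx0].
  - apply: intmx_col; apply/intmx_row; split=> //;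
      [exact: intmx1 | | exact: intmx0].
    by rewrite -[- _]add0r; apply: intmxB; [exact: intmx0 | exact: intmxM].
pose d1 k := if k is k'.+1 then d k' else 1.
have dM : M = X' *m smith_diag (1 + m) (1 + n) d1 *m Y'.
  rewrite (_ : smith_diag _ _ _ = block_mx 1 0 0 (smith_diag m n d)); last first.
    by apply/matrixP=> k l; do 3?[rewrite ?mxE ?ord1 //=; case: splitP => ? ->].
  rewrite !mulmx_block !(mul0mx, mulmx0, addr0) !mulmx1 add0r mul1mx -M00 -dM1.
  by rewrite addNKr submxK.
exists (tperm_mx i 0 *m X'), (Y' *m tperm_mx j 0), (fun k => a * d1 k); split.
- exact: intunitM (intunit_perm _) uX'.
- exact: intunitM uY' (intunit_perm _).
- have -> : smith_diag m.+1 n.+1 (fun k => a * d1 k) =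
      a *: smith_diag (1 + m) (1 + n) d1.
    by apply/matrixP => k l; rewrite !mxE mulrnAr.
  rewrite -scalemxAr -!mulmxA -!scalemxAl !mulmxA.
  rewrite -(mulmxA _ X') -(mulmxA _ _ Y') -dM /M xcolE xrowE -scalemxAr.
  rewrite -!scalemxAl scalerA mulfV // scale1r !mulmxA.
  rewrite -!mulmxA -perm_mxM tperm2 perm_mx1 mulmx1 mulmxA.
  by rewrite -perm_mxM tperm2 perm_mx1 mul1mx.
- move=> [|k] /=.
    (* As [d1] starts with 1, the first quotient is [d 0], integral because [M1] is. *)
    by exists (d 0%N); [exact: id | rewrite mulr1 mulrC].
  by have [q iq ->] := dd k; exists q => //; rewrite mulrCA.
- move=> iC k; apply: val_ge0M; first exact: iC.
  by case: k => [|k] /=; [exact: val_ge_int1 | exact: id].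
Qed.

End IntegralMatrices.

(** * Normal form of a lattice *)

Section BijectiveHom.
Variables (F : fieldType).
Implicit Types U V W : vectType F.

Lemma bij_lfunK U V (f : 'Hom(U, V)) : bijective f -> cancel f (f^-1)%VF.
Proof. by move=> /bij_inj fi; apply/lker0_lfunK/lker0P. Qed.

Lemma bij_lfunVK U V (f : 'Hom(U, V)) : bijective f -> cancel (f^-1)%VF f.
Proof.
by move=> fb w; case: (fb) => g fg gf; rewrite -[w]gf bij_lfunK.
Qed.

Lemma bij_lfunV U V (f : 'Hom(U, V)) : bijective f -> bijective (f^-1)%VF.
Proof. by move=> fb; exists f; [exact: bij_lfunVK | exact: bij_lfunK]. Qed.

Lemma bij_comp_lfun U V W (f : 'Hom(V, W)) (g : 'Hom(U, V)) :
  bijective f -> bijective g -> bijective (f \o g)%VF.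
Proof.
move=> fb gb; apply: (eq_bij (bij_comp fb gb)) => x.
by rewrite comp_lfunE.
Qed.

Lemma bij_mulmxr n (B : 'M[F]_n) : B \in unitmx ->
  bijective (linfun (mulmxr B : 'rV_n -> 'rV_n)).
Proof.
move=> uB; exists (mulmxr (invmx B)) => x; rewrite lfunE /=.
  by rewrite mulmxK.
by rewrite mulmxKV.
Qed.

Lemma bij_lfun_inj V (f : 'End(V)) : injective f -> bijective f.
Proof.
move=> fi; have k0 : lker f == 0%VS by apply/lker0P.
exists (f^-1)%VF; first exact: lker0_lfunK.
by move=> w; apply: limg_lfunVK; rewrite lker0_limgf ?memvf.
Qed.

End BijectiveHom.

(** * Lattices as images of integral row vectors *)

Section Lattices.
Variables (F : fieldType) (v : discrete_valuation F) (V : vectType F).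

Lemma bij_lattice n (chi : 'Hom('rV[F]_n, V)) : bijective chi ->
  is_lattice v [set chi c | c in [set c | intmx v c]].
Proof.
move=> bchi; exists n, (fun i => chi (delta_mx 0 i)).
have sumE (c : 'I_n -> F) :
    \sum_(i < n) c i *: chi (delta_mx 0 i) = chi (\row_i c i).
  rewrite [\row_i _]row_sum_delta linear_sum; apply: eq_bigr => i _.
  by rewrite linearZ mxE.
split.
- apply/seteqP; split=> u [c hc <-].
    exists (c 0) => [i|]; first exact: hc.
    by rewrite sumE; congr (chi _); apply/rowP => i; rewrite mxE.
  exists (\row_i c i); last by rewrite sumE.
  by move=> i j; rewrite mxE; apply: hc.
- move=> c _; rewrite sumE -(linear0 chi) => /(bij_inj bchi) /rowP c0 i.
  by have := c0 i; rewrite !mxE.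
move=> U hU; apply/vspaceP => u; rewrite memvf -(bij_lfunVK bchi u).
rewrite [(chi^-1)%VF u]row_sum_delta linear_sum; apply: memv_suml => i _.
rewrite linearZ; apply/memvZ/hU; exists (delta_mx 0 i) => //.
by move=> k j; rewrite mxE; case: (_ && _); [exact: val_ge_int1 | left].
Qed.

Lemma common_denominator n (c : 'I_n -> F) :
  exists2 s, s != 0 & forall i, val_ge v 0 (s * c i).
Proof.
(* The sum of all [|v (c i)|] bounds each [- v (c i)]; the arbitrary value at a zero coordinate only
   enlarges it. *)
have [s s0 vs] := dval_onto v ((\sum_(i < n) `|v (c i)|)%N : nat)%:Z.
exists s => // i; have [->|ci0] := eqVneq (c i) 0; first by rewrite mulr0; left.
right; rewrite dvalM // vs (bigD1 i) //=; lia.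
Qed.

(** Generators free over the ring of integers are free over [F], by clearing denominators in a
    relation. As they also span [V], there are [n] of them and they define an isomorphism. *)
Lemma lattice_bij (n : nat) (L : set V) : \dim {:V} = n -> is_lattice v L ->
  exists2 chi : 'Hom('rV[F]_n, V), bijective chi &
    L = [set chi c | c in [set c | intmx v c]].
Proof.
move=> dimV [m [e [defL free span]]].
pose f (c : 'rV[F]_m) := \sum_(i < m) c 0 i *: e i.
have lf : linear f.
  move=> a x y; rewrite /f scaler_sumr -big_split; apply: eq_bigr => i _ /=.
  by rewrite !mxE scalerDl scalerA.
pose fL : {linear 'rV[F]_m -> V} := HB.pack f (GRing.isLinear.Build _ _ _ _ f lf).
pose chi := linfun fL; have chiE c : chi c = f c by rewrite lfunE.
have ker0 : lker chi == 0%VS.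
  apply/lker0P => x y /eqP; rewrite -subr_eq0 -linearB /= chiE => /eqP h.
  apply/eqP; rewrite -subr_eq0; apply/eqP/rowP => i; rewrite [RHS]mxE.
  have [s s0 hs] := common_denominator ((x - y) 0).
  apply: (mulfI s0); rewrite mulr0; apply: (free (fun i => s * (x - y) 0 i)) => //.
  transitivity (s *: f (x - y)); last by rewrite h scaler0.
  rewrite scaler_sumr; apply: eq_bigr => k _.
  by rewrite scalerA.
have img : limg chi = fullv.
  apply: span => u; rewrite defL => -[c _ <-].
  have -> : \sum_(i < m) c i *: e i = chi (\row_i c i).
    by rewrite chiE; apply: eq_bigr => i _; rewrite mxE.
  exact/memv_img/memvf.
have mn : m = n.
  rewrite -dimV -img limg_dim_eq ?(eqP ker0) ?capv0 // dimvf /dim /=.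
  by rewrite mul1n.
subst m; exists chi.
  exists (chi^-1)%VF; first exact: lker0_lfunK.
  by move=> w; apply: limg_lfunVK; rewrite img memvf.
rewrite defL; apply/seteqP; split=> u [c hc <-].
  exists (\row_i c i); first by move=> i j; rewrite mxE; apply: hc.
  by rewrite chiE; apply: eq_bigr => i _; rewrite mxE.
by exists (c 0) => [i|]; [apply: hc | rewrite chiE].
Qed.

End Lattices.

(** * Frames compatible with the decomposition, and standard lattices *)

Section Frames.
Variables (F : fieldType) (v : discrete_valuation F) (V : vectType F).
Variables (W1 W2 : {vspace V}) (n1 n2 : nat).

(** When [V] is the direct sum of [W1] and [W2], this is a basis of [W1] followed by one of [W2],
    packaged as a coordinate isomorphism. *)
Definition frame (phi : 'Hom('rV[F]_(n1 + n2), V)) : Prop :=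
  [/\ bijective phi, forall x, phi (row_mx x 0) \in W1
    & forall z, phi (row_mx 0 z) \in W2].

Lemma frame_mul phi (A : 'M_n1) (D : 'M_n2) :
    frame phi -> A \in unitmx -> D \in unitmx ->
  exists2 psi, frame psi &
    forall x z, psi (row_mx x z) = phi (row_mx (x *m A) (z *m D)).
Proof.
move=> [bphi h1 h2] uA uD; pose B := block_mx A 0 0 D.
pose psi := (phi \o linfun (mulmxr B : 'rV_(n1 + n2) -> 'rV_(n1 + n2)))%VF.
have psiE x z : psi (row_mx x z) = phi (row_mx (x *m A) (z *m D)).
  rewrite /psi comp_lfunE lfunE /= /B mul_row_block !mulmx0.
  by rewrite addr0 add0r.
exists psi => //; split=> [|x|z]; last 2 first.
- by rewrite psiE mul0mx.
- by rewrite psiE mul0mx.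
apply: bij_comp_lfun => //; apply: bij_mulmxr.
by rewrite block_diag_mx_unit uA.
Qed.

Hypothesis le_n12 : (n1 <= n2)%N.
Implicit Type alpha : {ffun 'I_n1 -> nat}.
Local Notation widen := (widen_ord le_n12).

Lemma ord_widenP (j : 'I_n2) : (exists i, j = widen i) \/ (n1 <= j)%N.
Proof.
have [ji|] := ltnP j n1; last by right.
by left; exists (Ordinal ji); apply: val_inj.
Qed.

Lemma mul_smith_widen (x : 'rV[F]_n1) d i :
  (x *m smith_diag n1 n2 d) 0 (widen i) = x 0 i * d i.
Proof.
rewrite mxE (bigD1 i) //= mxE eqxx big1 ?addr0 // => k ki.
by rewrite mxE /= (_ : (k == i :> nat) = false) ?mulr0n ?mulr0 //; apply: negbTE.
Qed.

Lemma mul_smith_ge (x : 'rV[F]_n1) d (j : 'I_n2) : (n1 <= j)%N ->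
  (x *m smith_diag n1 n2 d) 0 j = 0.
Proof.
move=> le_j; rewrite mxE big1 // => k _; rewrite mxE.
by rewrite ltn_eqF ?mulr0n ?mulr0 //; apply: leq_trans le_j.
Qed.

Definition adapted alpha (x : 'rV[F]_n1) (z : 'rV[F]_n2) :=
  [/\ intmx v x, intmx v z
    & forall i, val_ge v (alpha i)%:Z (z 0 (widen i) - x 0 i)].

Definition std_lattice phi alpha : set V :=
  [set u | exists x z, adapted alpha x z /\ u = phi (row_mx x z)].

(** Adapted pairs are the pairs [(x, x E + y T)] with [x], [y] integral, where [E] pads [x] with
    zeros and [T] is the diagonal matrix of [t]. So the lattice is the image of the integral vectors
    under [phi] composed with an invertible block triangular matrix. *)
Lemma std_is_lattice (pi : F) phi alpha : uniformizer v pi ->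
  frame phi -> is_lattice v (std_lattice phi alpha).
Proof.
move=> hpi [bphi _ _]; have [pi0 vpi] := hpi.
(* From index [n1] on, [adapted] demands only integrality, hence the default 1. *)
pose t (j : 'I_n2) := if insub (val j) is Some i then pi ^+ alpha i else 1.
have tw i : t (widen i) = pi ^+ alpha i by rewrite /t /= valK.
have tge (j : 'I_n2) : (n1 <= j)%N -> t j = 1.
  by move=> h; rewrite /t insubN // -leqNgt.
have t0 j : t j != 0.
  by rewrite /t; case: insub => [i|]; rewrite ?expf_neq0 ?oner_eq0.
have vt i : v (pi ^+ alpha i) = alpha i by rewrite dvalX // vpi mul1r.
pose E := smith_diag n1 n2 (fun=> 1 : F).
pose B := block_mx 1%:M E 0 (diag_mx (\row_j t j)).
have uB : B \in unitmx.
  rewrite unitmxE det_ublock det1 mul1r det_diag unitfE.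
  by apply/prodf_neq0 => j _; rewrite mxE.
have := bij_lattice v (bij_comp_lfun bphi (bij_mulmxr uB)).
set chi := (_ \o _)%VF.
have chiE x y : chi (row_mx x y) =
    phi (row_mx x (x *m E + y *m diag_mx (\row_j t j))).
  by rewrite /chi comp_lfunE lfunE /= mul_row_block mulmx1 mulmx0 addr0.
congr is_lattice; apply/seteqP; split=> u.
  move=> [c hc <-]; rewrite -(hsubmxK c) in hc *.
  move: (lsubmx c) (rsubmx c) hc => x y /intmx_row [hx hy].
  exists x, (x *m E + y *m diag_mx (\row_j t j)); split; last exact: chiE.
  split=> //.
    apply: intmxD; apply: intmxM => // i j; rewrite mxE.
      by case: eqP => _; [exact: val_ge_int1 | left].
    case: eqP => [->|_]; last by left.
    rewrite mulr1n mxE; right; have [[k ->]|/tge->] := ord_widenP j.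
      by rewrite tw vt.
    by rewrite dval1.
  move=> i; rewrite mxE mul_smith_widen mulr1 addrAC subrr add0r.
  rewrite mul_mx_diag mxE mxE tw mulrC -[X in val_ge _ X]addr0 -vt.
  by apply/val_ge_shift; rewrite ?expf_neq0.
move=> [x [z [[hx hz hxz] ->]]].
exists (row_mx x (\row_j ((z - x *m E) 0 j / t j))).
  apply/intmx_row; split=> // i j; rewrite !mxE.
  have [[k ->]|jge] := ord_widenP j.
    rewrite [X in _ - X](_ : _ = x 0 k).
      by rewrite tw -(subrr (v (pi ^+ alpha k))) vt; apply: val_geM => //;
         right; rewrite dvalV ?expf_neq0 // vt.
    by have := mul_smith_widen x (fun=> 1) k; rewrite mxE mulr1.
  rewrite tge // divr1 [X in _ - X](_ : _ = 0).
    by rewrite subr0.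
  by have := mul_smith_ge x (fun=> 1) jge; rewrite mxE.
rewrite chiE; congr (phi (row_mx _ _)); apply/rowP => j.
by rewrite mul_mx_diag !mxE divfK // addrC subrK.
Qed.

(** Two applications of [smith]. Integral row operations, which only change the basis of the
    lattice, make its matrix block triangular with diagonal blocks [A], [D] and corner [C].
    Diagonalising [C D^-1] then describes the lattice by coordinates [(x, x S + y)] with [x], [y]
    integral and [S] diagonal, the frame absorbing the other factors. *)
Lemma normal_form phi0 L : frame phi0 -> is_lattice v L ->
  exists phi alpha,
    [/\ frame phi, decreasing_seqs alpha & L = std_lattice phi alpha].
Proof.
move=> fphi0 hL; have [bphi0 _ _] := fphi0.
have dimV : \dim {:V} = (n1 + n2)%N.
  have <- : limg phi0 = fullv.
    apply/vspaceP => u; rewrite memvf -(bij_lfunVK bphi0 u).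
    exact/memv_img/memvf.
  rewrite limg_dim_eq; first by rewrite dimvf /dim /= mul1n.
  by apply/eqP; rewrite capfv; apply/lker0P/bij_inj.
have [chi bchi ->] := lattice_bij dimV hL.
(* The rows of [B] are a basis of the lattice in the coordinates of [phi0]. *)
pose B := lin1_mx (phi0^-1 \o chi)%VF.
have mulB c : phi0 (c *m B) = chi c.
  by rewrite mul_rV_lin1 /= comp_lfunE bij_lfunVK.
have uB : B \in unitmx.
  suff /mulmx1_unit[] : B *m lin1_mx (chi^-1 \o phi0)%VF = 1%:M by [].
  apply/row_matrixP => i; rewrite !rowE mulmxA mulmx1 mul_rV_lin1 /= comp_lfunE.
  by rewrite mulB bij_lfunK.
(* Only the columns belonging to [W1] are diagonalised; their Smith form vanishes below the first
   [n1] rows. *)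
have [X [Y [d [uX uY dB _ _]]]] := smith v (lsubmx B).
have [[uX1 iX iX'] [uY1 iY iY']] := (uX, uY).
have d0 : dsubmx (smith_diag (n1 + n2) n1 d) = 0.
  apply/matrixP => i j; rewrite !mxE /= gtn_eqF //.
  exact: ltn_addr.
set S1 := usubmx (smith_diag (n1 + n2) n1 d).
pose R := invmx X *m rsubmx B; pose C := usubmx R; pose D := dsubmx R.
have XB : invmx X *m B = block_mx (S1 *m Y) C 0 D.
  rewrite -{1}(hsubmxK B) mul_mx_row dB -!mulmxA mulKmx // block_mxEh vsubmxK.
  by rewrite -{1}(vsubmxK (smith_diag _ _ _)) d0 mul_col_mx mul0mx.
set A := S1 *m Y in XB.
have [uA uD] : A \in unitmx /\ D \in unitmx.
  apply/andP; rewrite !unitmxE -unitrM -(det_ublock _ C) -XB.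
  by rewrite -unitmxE unitmx_mul unitmx_inv uX1.
have [X2 [Y2 [e [[uX2 iX2 iX2'] [uY2 iY2 iY2'] dC de _]]]] :=
  smith v (C *m invmx D).
(* If [e k] is integral, [x_k e_k] can be absorbed into [y_k] and the label is 0. Otherwise
   rescaling the coordinate by [e k] turns it into [x_k + y_k / e_k], whence the label [- v (e k)].
   Indices from [n1] on do not occur in [S]. *)
pose neg k := (k < n1)%N && (e k != 0) && (v (e k) < 0).
pose t (j : 'I_n2) := if neg j then e j else 1.
pose alpha : {ffun 'I_n1 -> nat} :=
  [ffun i : 'I_n1 => if neg i then `|v (e i)|%N else 0%N].
have t0 j : t j != 0.
  by rewrite /t; case: ifP => [/andP[/andP[_ ->]]|] //; rewrite oner_eq0.
have uT : diag_mx (\row_j t j) \in unitmx.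
  rewrite unitmxE det_diag unitfE; apply/prodf_neq0 => j _.
  by rewrite mxE.
set T := diag_mx _ in uT.
have uA' : invmx X2 *m A \in unitmx by rewrite unitmx_mul unitmx_inv uX2.
have uD' : T *m (Y2 *m D) \in unitmx by rewrite !unitmx_mul uT uY2.
have [phi fphi phiE] := frame_mul fphi0 uA' uD'.
exists phi, alpha; split=> //.
  (* Each [e i] divides the next entry, so [- v (e i)] does not increase with [i]. *)
  move=> i j ji; rewrite !ffunE /neg !ltn_ord /=.
  have [q iq ej] := de i; rewrite ji ej mulf_eq0 negb_or.
  case: ifP => // /andP[/andP[q0 ei0]]; case: iq => [q00|vq].
    by rewrite q00 eqxx in q0.
  rewrite dvalM // ei0 /=; move: (v q) (v (e i)) vq => a b; clear => a0 ab0.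
  by rewrite (_ : b < 0); lia.
set S := smith_diag n1 n2 e.
(* Coordinates, in the basis of the lattice, of a vector given in the new frame; [(x, z)] is adapted
   exactly when these are integral. *)
have keyE x z : phi (row_mx x z) =
    chi (row_mx (x *m invmx X2) ((z *m T - x *m S) *m Y2) *m invmx X).
  rewrite phiE -mulB -(mulmxA _ (invmx X)) XB mul_row_block mulmx0 addr0.
  rewrite !mulmxA; congr (phi0 (row_mx _ _)).
  rewrite [in X in X + _](_ : C = X2 *m S *m Y2 *m D); last first.
    by rewrite -dC mulmxKV.
  by rewrite !mulmxA mulmxKV // -!mulmxDl addrC subrK.
have tge (j : 'I_n2) : (n1 <= j)%N -> t j = 1.
  by move=> h; rewrite /t /neg ltnNge h.
have negF i : (i < n1)%N -> neg i = false -> val_ge v 0 (e i).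
  rewrite /neg => -> /=; case: eqVneq => [->|_] /=; first by left.
  by move=> h; right; rewrite leNgt h.
apply/seteqP; split=> u.
  move=> [c hc <-].
  pose x := lsubmx (c *m X) *m X2.
  pose y := rsubmx (c *m X) *m invmx Y2.
  have [hl hr] : intmx v (lsubmx (c *m X)) /\ intmx v (rsubmx (c *m X)).
    by apply/intmx_row; rewrite hsubmxK; apply: intmxM.
  have [hx hy] : intmx v x /\ intmx v y by split; apply: intmxM.
  pose z : 'rV_n2 := \row_j ((x *m S + y) 0 j / t j).
  exists x, z; split; last first.
    rewrite keyE (_ : z *m T = x *m S + y); last first.
      by apply/rowP => j; rewrite mul_mx_diag !mxE divfK.
    by rewrite addrAC subrr add0r mulmxKV // mulmxK // hsubmxK mulmxK.
  have zw i : val_ge v (alpha i) (z 0 (widen i) - x 0 i).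
    rewrite mxE mxE mul_smith_widen ffunE /t /=; case: ifP => [|/negF h].
      move=> /andP[/andP[_ ei0] vei]; rewrite mulrDl mulfK // addrAC subrr add0r.
      rewrite -(add0r `|_|%:Z); apply: val_geM => //; right.
      by rewrite dvalV //; move: (v (e i)) vei => k; clear; lia.
    rewrite divr1; apply: val_geB => //; apply: val_geD => //.
    by apply: val_ge0M => //; exact: h.
  split=> // i j; rewrite ord1; have [[k ->]|jge] := ord_widenP j.
    by rewrite -(subrK (x 0 k) (z 0 _)); apply: val_geD => //; apply: val_geW (zw k).
  by rewrite mxE tge // divr1 mxE mul_smith_ge // add0r.
move=> [x [z [[hx hz hxz] ->]]]; rewrite keyE.
set c := _ *m invmx X; exists c => //; apply: intmxM => //.
apply/intmx_row; split; apply: intmxM => // i j; rewrite ord1.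
rewrite mxE mul_mx_diag mxE mxE mxE.
have [[k ->]|jge] := ord_widenP j; last first.
  by rewrite mul_smith_ge // tge // subr0 mulr1.
rewrite mul_smith_widen /t /=; case: ifP => [nk|/negF h].
  rewrite -mulrBl; have := hxz k; rewrite ffunE nk => hk.
  case/andP: nk => _ vek.
  rewrite (_ : 0 = `|v (e k)|%N%:Z + v (e k)).
    exact/val_geM/val_ge_refl.
  by move: (v (e k)) vek => a; clear; lia.
rewrite mulr1; apply: val_geB => //.
by apply: val_ge0M => //; exact: h.
Qed.

End Frames.

(** * Invariants of the quotient *)

Section Quotients.
Variables (F : fieldType) (v : discrete_valuation F) (pi : F).
Hypothesis hpi : uniformizer v pi.

Definition submodule (U : lmodType F) (M : set U) : Prop :=
  M 0 /\ forall a x y, integers v a -> M x -> M y -> M (a *: x + y).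

Lemma submoduleZ (U : lmodType F) (M : set U) a x : submodule M ->
  integers v a -> M x -> M (a *: x).
Proof. by move=> [M0 Ml] ha hx; rewrite -[_ *: _]addr0; apply: Ml. Qed.

Lemma submoduleN (U : lmodType F) (M : set U) x : submodule M ->
  M x -> M (- x).
Proof.
move=> sM hx; rewrite -scaleN1r; apply: submoduleZ => //.
exact/val_geN/val_ge_int1.
Qed.

Lemma submoduleD (U : lmodType F) (M : set U) x y : submodule M ->
  M x -> M y -> M (x + y).
Proof.
move=> [_ Ml] hx hy; rewrite -[x]scale1r; apply: Ml => //.
exact: val_ge_int1.
Qed.

Lemma submoduleB (U : lmodType F) (M : set U) x y : submodule M ->
  M x -> M y -> M (x - y).
Proof. by move=> sM hx hy; apply: submoduleD => //; apply: submoduleN. Qed.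

Lemma coset_eqP (U : lmodType F) (N : set U) x y : submodule N ->
  coset N x = coset N y <-> N (x - y).
Proof.
move=> sN; split=> [exy|hxy].
  have : coset N x x by exists 0; [case: sN | rewrite addr0].
  by rewrite exy => -[z hz <-]; rewrite addrAC subrr add0r.
apply/seteqP; split=> _ [z hz <-].
  exists (x - y + z); first exact: submoduleD.
  by rewrite addrA addrCA subrr addr0.
exists (z - (x - y)); first exact: submoduleB.
by rewrite opprB addrCA (addrC x) subrK addrC.
Qed.

(* The elements pi^k x_i of M / N satisfy no relation with a unit coefficient.
   For a finitely generated torsion M / N such x_i exist iff pi^k (M / N) needs
   at least r generators; in this form monotonicity in M and N is immediate. *)
Definition rank_ge (U : lmodType F) (M N : set U) (k r : nat) : Prop :=
  exists x : 'I_r -> U, (forall i, M (x i)) /\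
    forall c : 'I_r -> F, (forall i, val_ge v 0 (c i)) ->
      N (pi ^+ k *: \sum_(i < r) c i *: x i) -> forall i, val_ge v 1 (c i).

Lemma integers_pi k : integers v (pi ^+ k).
Proof. by case: hpi => pi0 vpi; right; rewrite dvalX // vpi mul1r. Qed.

(** The isomorphism acts on cosets, so it is replaced by a relation [rel] between representatives,
    which respects integral combinations and matches [N] with [N']. Witnesses are transported along
    [rel] in both directions. *)
Lemma quotient_iso_rank (U U' : lmodType F) (M N : set U) (M' N' : set U') k r :
    submodule M -> submodule N -> submodule M' -> submodule N' ->
  quotient_iso v M N M' N' -> rank_ge M N k r <-> rank_ge M' N' k r.
Proof.
move=> sM sN sM' sN' [f [[ffun finj fsurj] flin]].
pose rel u u' := [/\ M u, M' u' & f (coset N u) = coset N' u'].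
have rel0 : rel 0 0.
  have M0 : M 0 by case: sM.
  have [z Mz ez] : quotient_set M' N' (f (coset N 0)).
    by apply: ffun; exists 0.
  split=> //; first by case: sM'.
  (* Linearity applied to [-1 * 0 + 0] sends the zero coset to the coset of [- z + z]. *)
  have iN1 : integers v (-1) by apply/val_geN/val_ge_int1.
  have := flin (-1) 0 0 z z iN1 M0 M0 Mz Mz (esym ez) (esym ez).
  by rewrite scaler0 addr0 scaleN1r addNr.
have rel_lin a x y x' y' : integers v a -> rel x x' -> rel y y' ->
    rel (a *: x + y) (a *: x' + y').
  move=> ha [mx mx' ex] [my my' ey]; split; last exact: flin.
    by case: sM => _; apply.
  by case: sM' => _; apply.
have rel_mem u u' : rel u u' -> N u <-> N' u'.
  move=> [mu mu' eu]; rewrite -(subr0 u) -(subr0 u') -!coset_eqP //.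
  have [m0 m0' e0] := rel0; rewrite -eu -e0; split=> [->//|].
  by apply: finj; rewrite in_setE; [exists u | exists 0].
have rel_comb (x : 'I_r -> U) (x' : 'I_r -> U') c :
    (forall i, rel (x i) (x' i)) -> (forall i, val_ge v 0 (c i)) ->
    N (pi ^+ k *: \sum_(i < r) c i *: x i) <->
    N' (pi ^+ k *: \sum_(i < r) c i *: x' i).
  move=> hx hc; apply: rel_mem.
  have relZ a y y' : integers v a -> rel y y' -> rel (a *: y) (a *: y').
    by move=> ha hy; have := rel_lin _ _ _ _ _ ha hy rel0; rewrite !addr0.
  apply: relZ; first exact: integers_pi.
  elim/big_rec2: _ => [|i y y' _ hy]; first exact: rel0.
  by apply: rel_lin => //; apply: hc.
split=> [[x [Mx hx]]|[x' [Mx' hx']]].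
  have /choice[x' hx'] : forall i, exists x', rel (x i) x'.
    move=> i; have [z Mz ez] : quotient_set M' N' (f (coset N (x i))).
      by apply: ffun; exists (x i).
    by exists z; split.
  exists x'; split=> [i|c hc]; first by case: (hx' i).
  by rewrite -(rel_comb x) //; apply: hx.
have /choice[x hx] : forall i, exists x, rel x (x' i).
  move=> i; have : quotient_set M' N' (coset N' (x' i)) by exists (x' i).
  by move=> /fsurj[_ [z Mz <-] ez]; exists z; split.
exists x; split=> [i|c hc]; first by case: (hx i).
by rewrite (rel_comb _ x') //; apply: hx'.
Qed.

(** First isomorphism theorem for [h] followed by reduction modulo [N']. *)
Lemma linear_quotient_iso (U U' : lmodType F) (h : U -> U')
    (M N : set U) (M' N' : set U') :
    linear h -> submodule M -> submodule N -> submodule N' -> N `<=` M ->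
    (forall u, M u -> M' (h u)) ->
    (forall u', M' u' -> exists2 u, M u & h u = u') ->
    (forall u, M u -> N u <-> N' (h u)) ->
  quotient_iso v M N M' N'.
Proof.
move=> lh sM sN sN' NM hM hsurj hN.
(* The union of the cosets of all images, which collapses to a single coset when [S] belongs to
   [M / N]. *)
pose f (S : set U) : set U' := [set w | exists2 u, S u & coset N' (h u) w].
have hB x y : h (x - y) = h x - h y.
  by rewrite -scaleN1r addrC lh scaleN1r addrC.
have fE x : M x -> f (coset N x) = coset N' (h x).
  move=> Mx; apply/seteqP; split=> w.
    move=> [_ [y Ny <-]]; rewrite (_ : coset N' (h (x + y)) = coset N' (h x)) //.
    apply/coset_eqP => //; rewrite -hB addrAC subrr add0r.
    by apply/hN => //; apply: NM.
  by move=> hw; exists x => //; exists 0; [case: sN | rewrite addr0].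
exists f; split.
  split.
  - by move=> _ [x Mx <-]; rewrite fE //; exists (h x) => //; apply: hM.
  - move=> S S'; rewrite !in_setE => -[x Mx <-] [y My <-]; rewrite !fE //.
    rewrite !coset_eqP // -hB => h'; apply/hN => //.
    exact: submoduleB.
  - move=> _ [_ /hsurj[u Mu <-] <-]; exists (coset N u); first by exists u.
    exact: fE.
move=> a x y x' y' ha Mx My M'x' M'y'; rewrite !fE //; last first.
  by case: sM => _; apply.
rewrite !coset_eqP // lh => hx hy.
rewrite opprD addrACA -scalerBr; apply: submoduleD => //.
exact: submoduleZ.
Qed.

Lemma rank_image (U U' : lmodType F) (g : U -> U') (M N : set U) k r :
  linear g -> injective g ->
  rank_ge [set g u | u in M] [set g u | u in N] k r <-> rank_ge M N k r.
Proof.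
move=> lg ig; pose f : {linear U -> U'} := HB.pack g (GRing.isLinear.Build _ _ _ _ g lg).
have gE (c : 'I_r -> F) x : pi ^+ k *: \sum_(i < r) c i *: g (x i) =
    g (pi ^+ k *: \sum_(i < r) c i *: x i).
  rewrite -[RHS]/(f _) linearZ /=; congr (_ *: _); rewrite -[RHS]/(f _) (linear_sum f).
  by apply: eq_bigr => i _; rewrite linearZ.
split=> [[x [Mx hx]]|[x [Mx hx]]].
  have /choice[y hy] : forall i, exists y, M y /\ g y = x i.
    by move=> i; have [y My e] := Mx i; exists y.
  exists y; split=> [i|c hc hN]; first by case: (hy i).
  apply: hx => //; rewrite (eq_bigr (fun i => c i *: g (y i))); last first.
    by move=> i _; have [_ ->] := hy i.
  by rewrite gE; exists (pi ^+ k *: \sum_(i < r) c i *: y i).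
exists (fun i => g (x i)); split=> [i|c hc]; first by exists (x i).
by rewrite gE => -[u Nu /ig e]; apply: hx => //; rewrite -e.
Qed.

(** The witnesses are multiplied by [pi], which accounts for one power. This passes from a lattice
    to a smaller neighbour. *)
Lemma rank_step (U : lmodType F) (M N M' N' : set U) k r :
    (forall u, M u -> M' (pi *: u)) -> N' `<=` N ->
  rank_ge M N k.+1 r -> rank_ge M' N' k r.
Proof.
move=> hM hN [x [Mx hx]]; exists (fun i => pi *: x i); split=> [i|c hc].
  exact: hM.
move=> /hN h; apply: hx => //; congr N: h.
rewrite exprSr -scalerA; congr (_ *: _); rewrite scaler_sumr.
by apply: eq_bigr => i _; rewrite !scalerA mulrC.
Qed.

(** Here the witnesses stay the same and the power of [pi] carries [N'] into [N]. This passes from a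
    lattice to a larger neighbour. *)
Lemma rank_step_sub (U : lmodType F) (M N M' N' : set U) k r :
    M `<=` M' -> (forall u, N' u -> N (pi *: u)) ->
  rank_ge M N k.+1 r -> rank_ge M' N' k r.
Proof.
move=> hM hN [x [Mx hx]]; exists x; split=> [i|c hc]; first exact: hM.
by move=> /hN h; apply: hx => //; rewrite exprS -scalerA.
Qed.

Lemma decreasing_le n (alpha : {ffun 'I_n -> nat}) (i j : 'I_n) :
  decreasing_seqs alpha -> (i <= j)%N -> (alpha j <= alpha i)%N.
Proof.
move=> dec; case: j => j; elim: j => [|j IH] jn /= ij.
  by rewrite (_ : i = Ordinal jn) //; apply: val_inj => /=; lia.
move: ij; rewrite leq_eqVlt => /orP[/eqP e|ij].
  by rewrite (_ : i = Ordinal jn) //; apply: val_inj.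
apply: leq_trans (IH (ltnW jn) ij); exact: dec.
Qed.

(** * Rank invariants of a sum of cyclic modules *)

Section CyclicSum.
Variables (n : nat) (alpha : {ffun 'I_n -> nat}).

Definition int_rows : set 'rV[F]_n := [set x | forall i, integers v (x ord0 i)].
Definition pow_rows : set 'rV[F]_n :=
  [set x | forall i, ideal_pow v pi (alpha i) (x ord0 i)].

Lemma int_rows_submodule : submodule int_rows.
Proof.
split=> [i|a x y ha hx hy i]; first by rewrite mxE; left.
rewrite !mxE; apply: val_geD; last exact: hy.
exact/val_ge0M/hx.
Qed.

Lemma pow_rows_submodule : submodule pow_rows.
Proof.
split=> [i|a x y ha hx hy i]; first by apply/ideal_powP => //; rewrite mxE; left.
apply/ideal_powP => //; rewrite !mxE; apply: val_geD; last exact/ideal_powP/hy.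
rewrite -(add0r (alpha i)%:Z); apply: val_geM => //.
exact/ideal_powP/hx.
Qed.

(** The power [pi^k] kills the summand of index [l] iff [alpha l <= k]; as [alpha] decreases, the
    surviving summands form an initial segment. Indices start at 0, hence [i.+1]. *)
Lemma cyclic_sum_rank k (i : 'I_n) : decreasing_seqs alpha ->
  rank_ge int_rows pow_rows k i.+1 <-> (k < alpha i)%N.
Proof.
move=> dec; have [pi0 vpi] := hpi.
have vpik : v (pi ^+ k) = k by rewrite dvalX // vpi mul1r.
have le_in : (i.+1 <= n)%N by [].
split=> [[x [xint hx]]|lt_k].
  rewrite ltnNge; apply/negP => le_k.
  (* Beyond the first i coordinates pi^k annihilates everything, and i + 1
     vectors with i coordinates satisfy a primitive linear relation. *)
  pose A : 'M[F]_(i.+1, i) := \matrix_(a, b) x a 0 (widen_ord (ltnW le_in) b).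
  have : kermx A != 0.
    rewrite -mxrank_eq0 mxrank_ker -lt0n subn_gt0.
    by rewrite ltnS rank_leq_col.
  move=> /rowV0Pn[c /sub_kermxP cA c0].
  have [j0 cj0] : exists j, c 0 j != 0.
    apply/existsP; apply: contraNT c0 => /existsPn h.
    by apply/eqP/rowP => j; rewrite mxE; apply/eqP/negbNE/h.
  pose P := fun j => c 0 j != 0.
  case: (@arg_minP _ _ _ j0 P (fun j => v (c 0 j)) cj0) => j Pj mj.
  (* Dividing by the coefficient of least valuation keeps the relation integral and makes one
     coefficient 1, contradicting [hx]. *)
  have hc l : val_ge v 0 (c 0 l / c 0 j).
    rewrite -(subrr (v (c 0 j))); apply: val_ge_div => //.
    by have [->|h] := eqVneq (c 0 l) 0; [left | right; apply: mj].
  have := hx _ hc; case/(_ _ j); last first.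
    - by rewrite mulfV // dval1.
    - by move/eqP; rewrite mulfV // oner_eq0.
  move=> l; apply/ideal_powP => //; rewrite !mxE summxE.
  have [li|il] := ltnP l i.
    left; rewrite (eq_bigr (fun a => (c 0 j)^-1 * (c 0 a * A a (Ordinal li)))).
      rewrite -mulr_sumr; have /rowP/(_ (Ordinal li)) := cA.
      by rewrite !mxE => ->; rewrite !mulr0.
    move=> a _; rewrite !mxE mulrA (mulrC _^-1); congr (_ * x a _ _).
    exact: val_inj.
  have al : (alpha l <= k)%N by apply: leq_trans le_k; apply: decreasing_le.
  apply: (@val_geW _ _ k%:Z); first by lia.
  rewrite -vpik -[X in val_ge _ X]addr0; apply: val_geM; first exact: val_ge_refl.
  apply: val_ge_sum => a _; rewrite mxE; apply: val_ge0M => //.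
  exact: xint.
(* Conversely, the first [i + 1] standard vectors are witnesses. *)
pose w := widen_ord le_in.
exists (fun j => delta_mx 0 (w j)); split=> [j l|c hc hN j].
  by rewrite mxE; case: (_ && _); [exact: val_ge_int1 | left].
have /ideal_powP := hN (w j) => /(_ hpi).
rewrite mxE summxE (bigD1 j) //= big1 ?addr0; last first.
  move=> l lj; rewrite !mxE eqxx /= (_ : (w j == w l) = false) ?mulr0 //.
  by apply/negbTE; apply: contra lj => /eqP/(congr1 val) /= e; apply/eqP/val_inj.
rewrite !mxE !eqxx mulr1 => h.
apply/(val_ge_shift v _ _ (expf_neq0 k pi0)); apply: val_geW h; rewrite vpik.
have : (alpha i <= alpha (w j))%N by apply: decreasing_le => //=; rewrite -ltnS.
by move: lt_k; clear; lia.
Qed.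

End CyclicSum.

End Quotients.

(** * Labels of vertices *)

Section DirectSum.
Variables (F : fieldType) (V : vectType F) (W1 W2 : {vspace V}).
Hypothesis hV : (W1 + W2)%VS = fullv.
Hypothesis hdirect : directv (W1 + W2).

Lemma direct_cap : (W1 :&: W2)%VS = 0%VS.
Proof. exact/directv_addP. Qed.

Lemma daddv_piD u : daddv_pi W1 W2 u + daddv_pi W2 W1 u = u.
Proof. by apply: daddv_pi_add; rewrite ?direct_cap // hV memvf. Qed.

Lemma daddv_pi_ker u : u \in W2 -> daddv_pi W1 W2 u = 0.
Proof.
move=> uW2; apply: (@addIr _ (daddv_pi W2 W1 u)).
by rewrite daddv_piD add0r daddv_pi_id // capvC direct_cap.
Qed.

Lemma daddv_pi_mem u : (u \in W1) = (daddv_pi W1 W2 u == u).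
Proof.
apply/idP/eqP => [uW1|<-]; last exact: memv_pi.
by rewrite daddv_pi_id // direct_cap.
Qed.

Lemma exists_frame : exists phi, @frame F V W1 W2 (\dim W1) (\dim W2) phi.
Proof.
set n1 := \dim W1; set n2 := \dim W2.
pose s1 (c : 'rV[F]_(n1 + n2)) := \sum_(i < n1) lsubmx c 0 i *: (vbasis W1)`_i.
pose s2 (c : 'rV[F]_(n1 + n2)) := \sum_(i < n2) rsubmx c 0 i *: (vbasis W2)`_i.
pose f c := s1 c + s2 c.
have lf : linear f.
  move=> a x y; rewrite /f /s1 /s2 scalerDr addrACA !scaler_sumr -!big_split /=.
  by congr (_ + _); apply: eq_bigr => i _; rewrite !mxE scalerDl scalerA.
have s1W c : s1 c \in W1.
  by apply: memv_suml => i _; apply/memvZ/vbasis_mem/mem_nth; rewrite size_tuple.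
have s2W c : s2 c \in W2.
  by apply: memv_suml => i _; apply/memvZ/vbasis_mem/mem_nth; rewrite size_tuple.
pose fL : {linear 'rV[F]_(n1 + n2) -> V} :=
  HB.pack f (GRing.isLinear.Build _ _ _ _ f lf).
exists (linfun fL); have fE c : linfun fL c = s1 c + s2 c by rewrite lfunE.
have free1 : free (vbasis W1) by apply/basis_free/vbasisP.
have free2 : free (vbasis W2) by apply/basis_free/vbasisP.
split=> [|x|z].
- exists (fun u => row_mx (\row_i coord (vbasis W1) i (daddv_pi W1 W2 u))
                          (\row_i coord (vbasis W2) i (daddv_pi W2 W1 u))).
    move=> c; rewrite fE.
    have e1 : daddv_pi W1 W2 (s1 c + s2 c) = s1 c.
      by rewrite linearD /= (daddv_pi_ker (s2W c)) addr0; apply/eqP; rewrite -daddv_pi_mem.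
    have e2 : daddv_pi W2 W1 (s1 c + s2 c) = s2 c.
      by apply: (@addrI _ (s1 c)); rewrite -{1}e1 daddv_piD.
    rewrite e1 e2 -[RHS]hsubmxK; congr row_mx; apply/rowP => i; rewrite mxE.
      by rewrite coord_sum_free.
    by rewrite coord_sum_free.
  move=> u; rewrite fE /s1 /s2 row_mxKl row_mxKr -[RHS]daddv_piD.
  rewrite [in RHS](coord_vbasis (memv_pi W1 W2 u)).
  rewrite [in RHS](coord_vbasis (memv_pi W2 W1 u)).
  by congr (_ + _); apply: eq_bigr => i _; rewrite mxE.
- rewrite fE /s2 row_mxKr big1 ?addr0 // => i _.
  by rewrite mxE scale0r.
rewrite fE /s1 row_mxKl big1 ?add0r // => i _.
by rewrite mxE scale0r.
Qed.

Section FrameDecomposition.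
Variables (n1 n2 : nat) (phi : 'Hom('rV[F]_(n1 + n2), V)).
Hypothesis fphi : frame W1 W2 phi.

Lemma frame_split x z : phi (row_mx x z) = phi (row_mx x 0) + phi (row_mx 0 z).
Proof. by rewrite -linearD add_row_mx addr0 add0r. Qed.

Lemma frame_pi1 x z : daddv_pi W1 W2 (phi (row_mx x z)) = phi (row_mx x 0).
Proof.
have [_ h1 h2] := fphi; rewrite frame_split linearD /= (daddv_pi_ker (h2 z)).
by rewrite addr0; apply/eqP; rewrite -daddv_pi_mem.
Qed.

Lemma frame_pi2 x z : daddv_pi W2 W1 (phi (row_mx x z)) = phi (row_mx 0 z).
Proof.
apply: (@addrI _ (phi (row_mx x 0))); rewrite -{1}(frame_pi1 x z).
by rewrite daddv_piD frame_split.
Qed.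

Lemma frame_mem1 x z : (phi (row_mx x z) \in W1) = (z == 0).
Proof.
have [bphi _ _] := fphi; rewrite daddv_pi_mem frame_pi1.
apply/eqP/eqP => [/(bij_inj bphi)/eq_row_mx[_ ->]|->] //.
Qed.

Lemma frame_mem2 x z : (phi (row_mx x z) \in W2) = (x == 0).
Proof.
have [bphi _ h2] := fphi; apply/idP/eqP => [/daddv_pi_ker|->] //.
rewrite frame_pi1 -(linear0 phi) => /(bij_inj bphi).
by rewrite -[RHS]row_mx0 => /eq_row_mx[].
Qed.

Lemma frame_surj u : exists x z, u = phi (row_mx x z).
Proof.
have [bphi _ _] := fphi; exists (lsubmx ((phi^-1)%VF u)), (rsubmx ((phi^-1)%VF u)).
by rewrite hsubmxK bij_lfunVK.
Qed.

End FrameDecomposition.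

Lemma subspace_bij_lfun (W : {vspace V}) (g : 'End(V)) : injective g ->
    (forall u, u \in W -> g u \in W) ->
  exists2 h : 'End(subvs_of W), bijective h & forall w, vsval (h w) = g (vsval w).
Proof.
move=> gi gW; exists (linfun (vsproj W \o (g \o vsval))); last first.
  by move=> w; rewrite lfunE /= vsprojK // gW // subvsP.
apply: bij_lfun_inj => w w'; rewrite !lfunE /= => /(congr1 vsval).
by rewrite !vsprojK ?gW ?subvsP // => /gi; apply: val_inj.
Qed.

(** The map preserves both summands, which are [z = 0] and [x = 0] in either frame; its restrictions
    are injective, hence bijective by dimension. *)
Lemma frame_levi n1 n2 (phi psi : 'Hom('rV[F]_(n1 + n2), V)) :
  frame W1 W2 phi -> frame W1 W2 psi -> levi W1 W2 (psi \o phi^-1)%VF.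
Proof.
move=> fphi fpsi; have [bphi _ _] := fphi; have [bpsi h1 h2] := fpsi.
set g := (_ \o _)%VF.
have gE c : g (phi c) = psi c by rewrite comp_lfunE bij_lfunK.
have gi : injective g by apply/bij_inj/bij_comp_lfun => //; exact: bij_lfunV.
have gW1 u : u \in W1 -> g u \in W1.
  have [x [z ->]] := frame_surj fphi u; rewrite frame_mem1 // => /eqP->.
  by rewrite gE.
have gW2 u : u \in W2 -> g u \in W2.
  have [x [z ->]] := frame_surj fphi u; rewrite frame_mem2 // => /eqP->.
  by rewrite gE.
have [g1 bg1 e1] := subspace_bij_lfun gi gW1.
have [g2 bg2 e2] := subspace_bij_lfun gi gW2.
by exists g1, g2; split=> // w1 w2; rewrite linearD e1 e2.
Qed.

(** These two properties let [g] carry the projection and the intersection of a lattice in [W1] to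
    those of its image. *)
Lemma levi_commute g : levi W1 W2 g ->
  injective g /\ forall u, g (daddv_pi W1 W2 u) = daddv_pi W1 W2 (g u).
Proof.
move=> [g1 [g2 [b1 b2 gE]]].
have decomp u : exists (w1 : subvs_of W1) (w2 : subvs_of W2),
      u = vsval w1 + vsval w2.
  exists (vsproj W1 (daddv_pi W1 W2 u)), (vsproj W2 (daddv_pi W2 W1 u)).
  by rewrite !vsprojK ?memv_pi // daddv_piD.
have piE (w1 : subvs_of W1) (w2 : subvs_of W2) :
    daddv_pi W1 W2 (vsval w1 + vsval w2) = vsval w1.
  rewrite linearD /= (daddv_pi_ker (subvsP w2)) addr0.
  by apply/eqP; rewrite -daddv_pi_mem subvsP.
have comm u : g (daddv_pi W1 W2 u) = daddv_pi W1 W2 (g u).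
  have [w1 [w2 ->]] := decomp u; rewrite gE !piE.
  by have := gE w1 0; rewrite !linear0 !addr0.
split=> // u u' guu'.
have [w1 [w2 eu]] := decomp u; have [w1' [w2' eu']] := decomp u'.
have e1 : w1 = w1'.
  apply/(bij_inj b1)/val_inj; have := congr1 (daddv_pi W1 W2) guu'.
  by rewrite eu eu' !gE !piE.
subst w1'; rewrite eu eu'; congr (_ + vsval _).
apply/(bij_inj b2)/val_inj; move: guu'; rewrite eu eu' !gE.
exact: addrI.
Qed.

End DirectSum.

Section HomothetyClasses.
Variables (F : fieldType) (V : vectType F).
Implicit Type L : set V.

Lemma mem_class L : homothety_class L L.
Proof.
exists 1; first by rewrite /= oner_neq0.
apply/seteqP; split=> u; last by exists u; rewrite ?scale1r.
by move=> [w hw <-]; rewrite scale1r.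
Qed.

Lemma act_class (g : 'End(V)) L :
  act g (homothety_class L) = homothety_class [set g u | u in L].
Proof.
have gZ a : [set g u | u in scale_set a L] = scale_set a [set g u | u in L].
  apply/seteqP; split=> _ [_ [u Lu <-] <-].
    by exists (g u); [exists u | rewrite linearZ].
  by exists (a *: u); [exists u | rewrite linearZ].
by apply/seteqP; split=> [_ [_ [a a0 <-] <-]|_ [a a0 <-]];
  [exists a | exists (scale_set a L); [exists a|]].
Qed.

End HomothetyClasses.

Lemma lattice_submodule (F : fieldType) (v : discrete_valuation F)
    (V : vectType F) (L : set V) : is_lattice v L -> submodule v L.
Proof.
move=> [n [e [-> _ _]]]; split.
  exists (fun=> 0); first by move=> i; left.
  by rewrite big1 // => i _; rewrite scale0r.
move=> a _ _ ha [c hc <-] [c' hc' <-]; exists (fun i => a * c i + c' i).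
  by move=> i; apply: val_geD; [apply: val_ge0M; [|exact: hc] | exact: hc'].
rewrite scaler_sumr -big_split; apply: eq_bigr => i _ /=.
by rewrite scalerDl scalerA.
Qed.

Lemma label_dist_leP n (alpha beta : {ffun 'I_n -> nat}) d :
  (label_dist alpha beta <= d)%N <->
  forall i, (alpha i <= beta i + d)%N /\ (beta i <= alpha i + d)%N.
Proof.
split=> [/bigmax_leqP h i|h]; first by have := h i isT; lia.
by apply/bigmax_leqP => i _; have := h i; lia.
Qed.

(** * Labels of orbits and the lower bound *)

Section Labels.
Variables (F : fieldType) (v : discrete_valuation F) (pi : F).
Hypothesis hpi : uniformizer v pi.
Variables (V : vectType F) (W1 W2 : {vspace V}).
Hypothesis hV : (W1 + W2)%VS = fullv.
Hypothesis hdirect : directv (W1 + W2).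
Hypothesis le_n12 : (\dim W1 <= \dim W2)%N.
Local Notation n1 := (\dim W1).
Local Notation n2 := (\dim W2).
Local Notation widen := (widen_ord le_n12).
Local Notation framed := (@frame F V W1 W2 n1 n2).
Local Notation std := (@std_lattice F v V n1 n2 le_n12).
Implicit Types (alpha beta : {ffun 'I_n1 -> nat}) (L : set V).

Lemma proj_submodule (W W' : {vspace V}) L :
  submodule v L -> submodule v (proj_lattice W W' L).
Proof.
move=> [L0 Ll]; split; first by exists 0; rewrite ?linear0.
move=> a _ _ ha [u hu <-] [w hw <-]; exists (a *: u + w); first exact: Ll.
by rewrite linearP.
Qed.

Lemma inter_submodule (W : {vspace V}) L :
  submodule v L -> submodule v (inter_lattice W L).
Proof.
move=> [L0 Ll]; split; first by split=> //=; rewrite mem0v.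
move=> a u w ha [hu Wu] [hw Ww]; split; first exact: Ll.
by rewrite /= memvD // memvZ.
Qed.

Lemma inter_sub_proj L : inter_lattice W1 L `<=` proj_lattice W1 W2 L.
Proof.
move=> u [Lu Wu]; exists u => //; apply/eqP.
by rewrite -daddv_pi_mem.
Qed.

Lemma inter_sub_proj2 L : inter_lattice W2 L `<=` proj_lattice W2 W1 L.
Proof.
move=> u [Lu Wu]; exists u => //; rewrite daddv_pi_id //.
by rewrite capvC direct_cap.
Qed.

(** In the coordinate [x], the projection to [W1] is everything integral, and the intersection,
    where [z = 0], requires [x_i] in P^(alpha i). For [W2] the first [n1] coordinates of [z] behave
    likewise; the others range over all integers in both modules and vanish in the quotient. *)
Lemma std_Q_iso phi alpha : framed phi -> Q_iso v pi W1 W2 (std phi alpha) alpha.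
Proof.
move=> fphi; have [bphi _ _] := fphi.
have sL := lattice_submodule (std_is_lattice le_n12 alpha hpi fphi).
have sP := pow_rows_submodule hpi alpha.
have vphi x z : (phi^-1)%VF (phi (row_mx x z)) = row_mx x z by rewrite bij_lfunK.
have alpha0 (i : 'I_n1) (r : F) : val_ge v (alpha i) r -> val_ge v 0 r.
  exact: val_geW.
split.
  pose h u := lsubmx ((phi^-1)%VF u).
  have hE x z : h (phi (row_mx x z)) = x by rewrite /h vphi row_mxKl.
  apply: (linear_quotient_iso (h := h)) => //.
  - by move=> a u w; rewrite /h linearP linearP.
  - exact: proj_submodule.
  - exact: inter_submodule.
  - exact: inter_sub_proj.
  - move=> _ [_ [x [z [[hx _ _] ->]]] <-]; rewrite frame_pi1 // hE => i.
    exact: hx.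
  - move=> x hx; exists (phi (row_mx x 0)); last exact: hE.
    (* Padding [x] with zeros gives a [z] that agrees with it in the first [n1] coordinates. *)
    exists (phi (row_mx x (x *m smith_diag n1 n2 (fun=> 1)))).
      exists x, (x *m smith_diag n1 n2 (fun=> 1)); split=> //; split.
      + by move=> i j; rewrite ord1; apply: hx.
      + apply: intmxM => i j; rewrite ?mxE ?ord1; first exact: hx.
        by case: eqP => _; [exact: val_ge_int1 | left].
      + by move=> i; rewrite mul_smith_widen mulr1 subrr; left.
    by rewrite frame_pi1.
  move=> _ [_ [x [z [[hx hz hxz] ->]]] <-]; rewrite frame_pi1 // hE.
  split=> [[[x' [z' [[_ _ hxz'] e]]] _] i|hN].
    have [ex ez] := eq_row_mx (bij_inj bphi e); apply/ideal_powP => //.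
    rewrite ex -[x' _ _]opprK; apply: val_geN.
    by have := hxz' i; rewrite -ez mxE add0r.
  split; last by rewrite /= (frame_mem1 hV hdirect fphi).
  exists x, 0; split=> //; split=> //; first exact: intmx0.
  by move=> i; rewrite mxE add0r; apply: val_geN; have /ideal_powP := hN i; exact.
pose h u : 'rV[F]_n1 := \row_i (rsubmx ((phi^-1)%VF u)) 0 (widen i).
have hE x z : h (phi (row_mx x z)) = \row_i z 0 (widen i).
  by rewrite /h vphi row_mxKr.
apply: (linear_quotient_iso (h := h)) => //.
- by move=> a u w; rewrite /h linearP linearP; apply/rowP => i; rewrite !mxE.
- exact: proj_submodule.
- exact: inter_submodule.
- exact: inter_sub_proj2.
- move=> _ [_ [x [z [[_ hz _] ->]]] <-]; rewrite frame_pi2 // hE => i.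
  by rewrite mxE; apply: hz.
- move=> x hx; set z := x *m smith_diag n1 n2 (fun=> 1).
  have zw i : z 0 (widen i) = x 0 i by rewrite mul_smith_widen mulr1.
  exists (phi (row_mx 0 z)); last first.
    by rewrite hE; apply/rowP => i; rewrite mxE zw.
  exists (phi (row_mx x z)); last by rewrite frame_pi2.
  exists x, z; split=> //; split.
  + by move=> i j; rewrite ord1; apply: hx.
  + apply: intmxM => i j; rewrite ?mxE ?ord1; first exact: hx.
    by case: eqP => _; [exact: val_ge_int1 | left].
  + by move=> i; rewrite zw subrr; left.
move=> _ [_ [x [z [[hx hz hxz] ->]]] <-]; rewrite frame_pi2 // hE.
split=> [[[x' [z' [[_ _ hxz'] e]]] _] i|hN].
  have [ex ez] := eq_row_mx (bij_inj bphi e); apply/ideal_powP => //.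
  by have := hxz' i; rewrite -ex -ez !mxE subr0.
split; last by rewrite /= (frame_mem2 hV hdirect fphi).
exists 0, z; split=> //; split=> //; first exact: intmx0.
by move=> i; have /ideal_powP := hN i; rewrite !mxE subr0; apply.
Qed.

Definition lattice_rank_ge L k r : Prop :=
  rank_ge v pi (proj_lattice W1 W2 L) (inter_lattice W1 L) k r.

(** Covers homotheties and Levi elements at once. *)
Lemma lattice_rank_image (g : V -> V) L k r : linear g -> injective g ->
    (forall u, g (daddv_pi W1 W2 u) = daddv_pi W1 W2 (g u)) ->
  lattice_rank_ge [set g u | u in L] k r <-> lattice_rank_ge L k r.
Proof.
move=> lg ig comm; rewrite /lattice_rank_ge.
rewrite (_ : proj_lattice _ _ _ = [set g u | u in proj_lattice W1 W2 L]); last first.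
  apply/seteqP; split=> _ [_ [u Lu <-] <-].
    by exists (daddv_pi W1 W2 u); [exists u | exact: comm].
  by exists (g u); [exists u | rewrite comm].
rewrite (_ : inter_lattice _ _ = [set g u | u in inter_lattice W1 L]); last first.
  apply/seteqP; split=> [_ [[u Lu <-]]|_ [u [Lu Wu] <-]].
    rewrite /= (daddv_pi_mem hdirect) -comm => /eqP/ig e; exists u => //.
    by split=> //=; rewrite (daddv_pi_mem hdirect) e.
  split; first by exists u.
  by move: Wu; rewrite /= !(daddv_pi_mem hdirect) -comm => /eqP->.
exact: rank_image.
Qed.

(** Ranks replace the isomorphism class of [Q], because they can be compared between neighbouring
    lattices and still determine [alpha]. *)
Definition has_label (x : set (set V)) alpha : Prop := decreasing_seqs alpha /\
  forall L, x L -> forall k (i : 'I_n1),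
    lattice_rank_ge L k i.+1 <-> (k < alpha i)%N.

Lemma has_label_uniq x L alpha beta :
  x L -> has_label x alpha -> has_label x beta -> alpha = beta.
Proof.
move=> xL [_ ha] [_ hb]; apply/ffunP => i.
have lt k : (k < alpha i)%N <-> (k < beta i)%N by rewrite -(ha L) // -(hb L).
have := lt (alpha i); have := lt (beta i); rewrite !ltnn.
by case: ltngtP => // _ [h1 h2] [h3 h4]; [have := h1 isT | have := h4 isT].
Qed.

Lemma label_of_Q_iso L alpha : is_lattice v L -> decreasing_seqs alpha ->
  Q_iso v pi W1 W2 L alpha -> has_label (homothety_class L) alpha.
Proof.
move=> hL dec [iso _]; split=> // _ [a a0 <-] k i.
have sL := lattice_submodule hL.
rewrite lattice_rank_image; first last.
- by move=> u; rewrite linearZ.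
- exact: scalerI.
- by move=> b u w; rewrite scalerDr !scalerA mulrC.
rewrite /lattice_rank_ge (quotient_iso_rank hpi _ _ _ _ _ _ iso).
- exact: cyclic_sum_rank.
- exact: proj_submodule.
- exact: inter_submodule.
- exact: int_rows_submodule.
- exact: pow_rows_submodule.
Qed.

Lemma label_act g x alpha : levi W1 W2 g ->
  has_label x alpha -> has_label (act g x) alpha.
Proof.
move=> /(levi_commute hV hdirect)[ig comm] [dec h]; split=> // _ [L xL <-] k i.
rewrite lattice_rank_image //; first exact: h.
by move=> a u w; rewrite linearP.
Qed.

Lemma lattice_normal_form L : is_lattice v L ->
  exists phi alpha, [/\ framed phi, decreasing_seqs alpha & L = std phi alpha].
Proof.
have [phi0 fphi0] := exists_frame hV hdirect.
exact: normal_form fphi0.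
Qed.

Lemma std_label phi alpha : framed phi -> decreasing_seqs alpha ->
  has_label (homothety_class (std phi alpha)) alpha.
Proof.
move=> fphi dec; apply: label_of_Q_iso => //; last exact: std_Q_iso.
exact: std_is_lattice hpi fphi.
Qed.

Lemma vertex_label x : is_vertex v x -> exists alpha, has_label x alpha.
Proof.
move=> [L /lattice_normal_form[phi [alpha [fphi dec ->]]] ->].
by exists alpha; apply: std_label.
Qed.

Lemma std_orbit phi psi alpha : framed phi -> framed psi ->
  levi_orbit W1 W2 (homothety_class (std phi alpha))
    (homothety_class (std psi alpha)).
Proof.
move=> fphi fpsi; have [bphi _ _] := fphi.
exists (psi \o phi^-1)%VF; first exact: frame_levi.
rewrite act_class; congr homothety_class; apply/seteqP; split=> u.
  move=> [_ [x [z [hxz ->]]] <-]; exists x, z; split=> //.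
  by rewrite comp_lfunE bij_lfunK.
move=> [x [z [hxz ->]]]; exists (phi (row_mx x z)); first by exists x, z.
by rewrite comp_lfunE bij_lfunK.
Qed.

(** The choice by [xget] is forced: a sequence coming from any lattice in the orbit has the same
    ranks as [alpha], since these are constant on orbits. *)
Lemma orbit_labelE phi alpha : framed phi -> decreasing_seqs alpha ->
  orbit_label v pi W1 W2 n1
    (levi_orbit W1 W2 (homothety_class (std phi alpha))) = alpha.
Proof.
move=> fphi dec; apply: xget_unique.
  split=> //; exists (std phi alpha); split.
  - exact: std_is_lattice hpi fphi.
  - exact: std_orbit.
  - exact: std_Q_iso.
move=> beta [decb [L [hL [g lg eL] isoL]]].
apply: (has_label_uniq (mem_class L)); first exact: label_of_Q_iso.
by rewrite -eL; apply/label_act/std_label.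
Qed.

(** An edge costs one power of [pi]: were [alpha i] above [beta i + 1], the lattice [L'] would have
    rank [i + 1] at level [beta i], against its label. The other bound is symmetric. *)
Lemma incident_label x y alpha beta : incident pi x y ->
  has_label x alpha -> has_label y beta ->
  forall i, (alpha i <= (beta i).+1)%N /\ (beta i <= (alpha i).+1)%N.
Proof.
move=> [L [L' [xL yL' sub1 sub2]]] [_ ha] [_ hb] i.
split; rewrite leqNgt; apply/negP.
  move=> /(proj2 (ha L xL _ i)) h; suff: (beta i < beta i)%N by rewrite ltnn.
  apply/(hb L' yL'); move: h; apply: rank_step => [_ [u Lu <-]|u [L'u Wu]].
    by exists (pi *: u); [apply: sub1; exists u | rewrite linearZ].
  by split=> //; apply: sub2.
move=> /(proj2 (hb L' yL' _ i)) h; suff: (alpha i < alpha i)%N by rewrite ltnn.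
apply/(ha L xL); move: h; apply: rank_step_sub => [_ [u Lu <-]|u [Lu Wu]].
  by exists u => //; apply: sub2.
by split; [apply: sub1; exists u | rewrite /= memvZ].
Qed.

(** Induction along the walk with the triangle inequality. Nonemptiness supplies a representative;
    on the empty set [has_label] holds for every decreasing sequence. *)
Lemma walk_label_dist x y p alpha beta : x !=set0 -> walk v pi x y p ->
  has_label x alpha -> has_label y beta -> (label_dist alpha beta <= size p)%N.
Proof.
elim: p x alpha => [|z p IH] x alpha [L xL] [] /=.
  move=> _ <- ha hb; rewrite (has_label_uniq xL ha hb).
  by apply/label_dist_leP => i; rewrite addn0.
move=> /andP[/asboolP[_ vz _ inc] pth] lst ha hb.
have z0 : z !=set0 by case: vz => L' _ ->; exists L'; exact: mem_class.
have [gamma hg] := vertex_label vz.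
have /label_dist_leP h1 := IH z gamma z0 (conj pth lst) hg hb.
have h2 := incident_label inc ha hg.
apply/label_dist_leP => i; have := h1 i; have := h2 i; lia.
Qed.

End Labels.

(** * Walks through standard lattices and the upper bound *)

Section StandardWalks.
Variables (F : fieldType) (v : discrete_valuation F) (pi : F).
Hypothesis hpi : uniformizer v pi.
Variables (V : vectType F) (W1 W2 : {vspace V}) (n1 n2 : nat).
Hypothesis le_n12 : (n1 <= n2)%N.
Local Notation framed := (@frame F V W1 W2 n1 n2).
Local Notation std := (@std_lattice F v V n1 n2 le_n12).
Implicit Types alpha beta : {ffun 'I_n1 -> nat}.

(** The new frame scales the [i]-th vector of each block by [pi ^+ s i]. As [s] is defined on all
    naturals, it serves both blocks, and it is 0 from [n1] on. *)
Lemma std_step phi alpha beta : framed phi -> (label_dist alpha beta <= 1)%N ->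
  exists2 psi, framed psi &
    incident pi (homothety_class (std phi alpha))
      (homothety_class (std psi beta)).
Proof.
move=> fphi /label_dist_leP hab; have [pi0 vpi] := hpi.
(* Where the label decreases, both basis vectors are multiplied by pi. *)
pose s (k : nat) : nat :=
  if insub k is Some i then (beta i < alpha i)%N else 0%N.
have sw (i : 'I_n1) : s i = (beta i < alpha i)%N by rewrite /s valK.
have s1 k : (s k <= 1)%N by rewrite /s; case: insub => // i; case: (_ < _)%N.
have vs k : v (pi ^+ s k) = s k by rewrite dvalX // vpi mul1r.
pose A n : 'M[F]_n := diag_mx (\row_i pi ^+ s i).
have uA n : A n \in unitmx.
  rewrite unitmxE det_diag unitfE; apply/prodf_neq0 => i _.
  by rewrite mxE expf_neq0.
have AE n (x : 'rV_n) i : (x *m A n) 0 i = pi ^+ s i * x 0 i.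
  by rewrite mul_mx_diag !mxE mulrC.
have [psi fpsi psiE] := frame_mul fphi (uA _) (uA _).
exists psi => //; exists (std phi alpha), (std psi beta).
split; try exact: mem_class.
  move=> _ [_ [x [z [[hx hz hxz] ->]]] <-].
  (* Since [s k] is at most 1, the factor [pi] pays for the division. *)
  have shift k r : val_ge v 0 r -> val_ge v 0 (pi * r / pi ^+ s k).
    move=> hr; apply: (@val_geW _ _ (1 + 0 - (s k)%:Z)).
      by have := s1 k; lia.
    rewrite -vs; apply: val_ge_div; first by rewrite expf_neq0.
    by rewrite -vpi; apply/val_ge_shift.
  exists (\row_i (pi * x 0 i / pi ^+ s i)), (\row_i (pi * z 0 i / pi ^+ s i)).
  split; last first.
    rewrite psiE -linearZ scale_row_mx; congr (phi (row_mx _ _)); apply/rowP => i.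
      by rewrite AE !mxE mulrCA mulfV ?mulr1 // expf_neq0.
    by rewrite AE !mxE mulrCA mulfV ?mulr1 // expf_neq0.
  split.
  - by move=> i j; rewrite mxE; apply: shift.
  - by move=> i j; rewrite mxE; apply: shift.
  move=> i; rewrite !mxE /= -mulrBl -mulrBr.
  (* Either [s i = 1] and [beta i < alpha i], or [s i = 0] and [beta i <= alpha i + 1]. *)
  apply: (@val_geW _ _ (1 + (alpha i)%:Z - (s i)%:Z)).
    by have := hab i; rewrite sw; case: ltnP; lia.
  rewrite -vs; apply: val_ge_div; first by rewrite expf_neq0.
  by rewrite -vpi; apply/val_ge_shift.
move=> _ [x [z [[hx hz hxz] ->]]].
exists (x *m A _), (z *m A _); split; last exact: psiE.
have hs k r : val_ge v 0 r -> val_ge v 0 (pi ^+ s k * r).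
  by move=> hr; apply: val_ge0M => //; right; rewrite vs.
split; try by move=> i j; rewrite ord1 AE; apply: hs.
move=> i; rewrite !AE /= -mulrBr.
(* Either [s i = 1] and [alpha i <= beta i + 1], or [s i = 0] and [alpha i <= beta i]. *)
apply: (@val_geW _ _ ((s i)%:Z + (beta i)%:Z)).
  by have := hab i; rewrite sw; case: ltnP; lia.
by rewrite -vs; apply: val_geM => //; exact: val_ge_refl.
Qed.

(** Induction on [d]: each step moves every entry of the label that differs from [beta] one unit
    towards it. *)
Lemma std_walk d phi alpha beta :
    framed phi -> (label_dist alpha beta <= d)%N ->
  exists psi p, [/\ framed psi, (size p <= d)%N &
    walk v pi (homothety_class (std phi alpha))
      (homothety_class (std psi beta)) p].
Proof.
elim: d phi alpha => [|d IH] phi alpha fphi /label_dist_leP hab.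
  exists phi, [::]; split=> //; split=> //=; congr (homothety_class (std _ _)).
  apply/ffunP => i; have := hab i; rewrite !addn0 => -[h1 h2].
  by apply/eqP; rewrite eqn_leq h1.
pose gamma : {ffun 'I_n1 -> nat} := [ffun i : 'I_n1 =>
  if (alpha i < beta i)%N then (alpha i).+1
  else if (beta i < alpha i)%N then (alpha i).-1 else alpha i].
have [|psi fpsi inc] := @std_step phi alpha gamma fphi.
  apply/label_dist_leP => i; rewrite ffunE.
  by have := hab i; case: (ltngtP (alpha i) (beta i)); lia.
have [|chi [p [fchi sp [pth lst]]]] := IH psi gamma fpsi.
  apply/label_dist_leP => i; rewrite ffunE.
  by have := hab i; case: (ltngtP (alpha i) (beta i)); lia.
have vert (f : 'Hom('rV[F]_(n1 + n2), V)) c : framed f ->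
    is_vertex v (homothety_class (std f c)).
  by move=> ff; exists (std f c) => //; exact: std_is_lattice hpi ff.
(* Adjacent vertices must be distinct, so a step that stays in place is dropped; hence only a bound
   on the length. *)
have [e|ne] :=
  EM (homothety_class (std phi alpha) = homothety_class (std psi gamma)).
  by exists chi, p; split=> //; [exact: leqW | rewrite e].
exists chi, (homothety_class (std psi gamma) :: p); split=> //; split=> //=.
by rewrite pth andbT; apply/asboolP; split=> //; apply: vert.
Qed.

End StandardWalks.

Theorem theorem3p3 (F : fieldType) (v : discrete_valuation F) (pi : F)
    (hpi : uniformizer v pi) (hres : finite_residue_field v pi)
    (V : vectType F) (W1 W2 : {vspace V})
    (hV : (W1 + W2)%VS = fullv) (hdirect : directv (W1 + W2))
    (n1 n2 : nat) (hn1 : \dim W1 = n1) (hn2 : \dim W2 = n2)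
    (n1_ge1 : (1 <= n1)%N) (n1_le_n2 : (n1 <= n2)%N)
    (L1 L2 : set V) (hL1 : is_lattice v L1) (hL2 : is_lattice v L2) :
  is_minimum
    [set d | exists x y, [/\ levi_orbit W1 W2 (homothety_class L1) x,
                             levi_orbit W1 W2 (homothety_class L2) y
                           & skeleton_dist v pi x y d]]
    (orbital_dist v pi W1 W2 (levi_orbit W1 W2 (homothety_class L1))
                             (levi_orbit W1 W2 (homothety_class L2))).
Proof.
subst n1 n2.
have [phi1 [alpha [f1 da eL1]]] := lattice_normal_form hV hdirect n1_le_n2 hL1.
have [phi2 [beta [f2 db eL2]]] := lattice_normal_form hV hdirect n1_le_n2 hL2.
rewrite /orbital_dist eL1 eL2 !(orbit_labelE hpi hV hdirect) //.
set x1 := homothety_class (std_lattice v n1_le_n2 phi1 alpha).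
set x2 := homothety_class (std_lattice v n1_le_n2 phi2 beta).
have h1 : has_label v pi W2 x1 alpha by exact: std_label.
have h2 : has_label v pi W2 x2 beta by exact: std_label.
(* Labels are constant on orbits, so the label bound applies to a walk between any two of their
   vertices. *)
have lower x y p : levi_orbit W1 W2 x1 x -> levi_orbit W1 W2 x2 y ->
    walk v pi x y p -> (label_dist alpha beta <= size p)%N.
  move=> [g lg <-] [g' lg' <-].
  move=> w; apply: (walk_label_dist hpi hV hdirect n1_le_n2 _ w);
    try exact: label_act.
  exists [set g u | u in std_lattice v n1_le_n2 phi1 alpha].
  by exists (std_lattice v n1_le_n2 phi1 alpha) => //; exact: mem_class.
split.
  (* The walk starts at [x1] itself and ends at a standard lattice with label [beta] in another
     frame, hence in the orbit of [x2]. *)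
  have [psi [p [fpsi sp w]]] :=
    std_walk hpi n1_le_n2 f1 (leqnn (label_dist alpha beta)).
  have o1 : levi_orbit W1 W2 x1 x1 by exact: std_orbit.
  have o2 := std_orbit v hV hdirect n1_le_n2 beta f2 fpsi.
  exists x1, (homothety_class (std_lattice v n1_le_n2 psi beta)); split=> //; split.
    (* The bound [lower] forces the length to equal the label distance, and next shows that no walk
       between these endpoints is shorter. *)
    by exists p => //; apply/eqP; rewrite eqn_leq sp (lower _ _ _ o1 o2 w).
  by move=> _ [q wq <-]; apply: lower wq.
by move=> _ [x [y [ox oy [[p w <-] _]]]]; apply: lower w.
Qed.
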